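(* For each dimension $d \ge 1$, let $c_d$ denote the smallest constant $c>0$ such that for all $\alpha>0$ and all $f \in L^1(\mathbb{R}^d)$, \[ \alpha \,\bigl|\{x\in\mathbb{R}^d : M_d f(x) \ge \alpha\}\bigr| \le c\, \|f\|_1, \] where $|\cdot|$ is Lebesgue measure and \[ M_d f(x) := \sup_{r>0} \frac{1}{|Q(x,r)|}\int_{Q(x,r)} |f(y)|\,dy, \] with $Q(x,r) = \{y\in\mathbb{R}^d : \max_{1\le i\le d}|y_i - x_i| \le r\}$ the closed cube centered at $x$ with sides parallel to the coordinate axes and sidelength $2r$. Then for every $T>0$ there exists $D = D(T)$ such that $c_d \ge T$ for every $d \ge D$. In particular, $c_d \to \infty$ as $d \to \infty$.
   Context: $M_d$ is the centered Hardy–Littlewood maximal operator associated to cubes (closed $\ell_\infty$ balls) and Lebesgue measure on $\mathbb{R}^d$; $c_d$ is the best constant in its weak type $(1,1)$ inequality. *)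

(* Defs.v *)
From mathcomp Require Import all_boot all_order all_algebra.
From mathcomp Require Import all_classical all_reals all_analysis.
Set Implicit Arguments. Unset Strict Implicit. Unset Printing Implicit Defensive.
Import Order.TTheory GRing.Theory Num.Theory.
Local Open Scope classical_set_scope.
Local Open Scope ring_scope.

(* R^d is modelled as d.-tuple R, with the product (= Borel) sigma-algebra
   provided by MathComp-Analysis. *)

Definition cube (R : realType) (d : nat) (x : d.-tuple R) (r : R) : set (d.-tuple R) :=
  [set y | forall i : 'I_d, `|tnth y i - tnth x i| <= r].

Definition box (R : realType) (d : nat) (a b : d.-tuple R) : set (d.-tuple R) :=
  [set y | forall i : 'I_d, tnth a i <= tnth y i <= tnth b i].

(* mu is Lebesgue measure on R^d (on its Borel sigma-algebra): it gives every
   closed box its volume.  This property characterizes Lebesgue measure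
   uniquely on the Borel sets (boxes form a generating pi-system). *)
Definition is_lebesgue_measure (R : realType) (d : nat)
    (mu : {measure set (d.-tuple R) -> \bar R}) : Prop :=
  forall a b : d.-tuple R, (forall i : 'I_d, tnth a i <= tnth b i) ->
    mu (box a b) = (\prod_(i < d) (tnth b i - tnth a i))%:E.

Definition maximal_fun (R : realType) (d : nat)
    (mu : {measure set (d.-tuple R) -> \bar R}) (f : d.-tuple R -> R)
    (x : d.-tuple R) : \bar R :=
  ereal_sup [set (((fine (mu (cube x r)))^-1)%:E *
                 \int[mu]_(y in cube x r) (`|f y|)%:E)%E | r in [set r : R | 0 < r]].

Definition weak11 (R : realType) (d : nat)
    (mu : {measure set (d.-tuple R) -> \bar R}) (c : R) : Prop :=
  forall (alpha : R) (f : d.-tuple R -> R), 0 < alpha ->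
    mu.-integrable setT (fun y => (f y)%:E) ->
    (alpha%:E * mu [set x | alpha%:E <= maximal_fun mu f x]
      <= c%:E * \int[mu]_y (`|f y|)%:E)%E.

(* best constant c_d (as an extended real: +oo if no constant works) *)
Definition best_weak11_const (R : realType) (d : nat)
    (mu : {measure set (d.-tuple R) -> \bar R}) : \bar R :=
  ereal_inf [set c%:E | c in [set c : R | 0 < c /\ weak11 mu c]].

(* Main.v *)
Require Import Defs.
From mathcomp Require Import all_boot all_order all_algebra.
From mathcomp Require Import all_classical all_reals all_analysis.
From mathcomp Require Import measurable_realfun.
From mathcomp Require Import ring lra zify.
Set Implicit Arguments. Unset Strict Implicit. Unset Printing Implicit Defensive.
Import Order.TTheory GRing.Theory Num.Theory.
Import numFieldNormedType.Exports.
Local Open Scope ring_scope.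

(* Split the coordinates into N blocks.  Take f to be a sum of tiny bumps at
   the points of a large piece of the lattice prod_i t_i Z, each of weight
   prod_i t_i, where t_i = p_j in block j and t_i = 1 outside the blocks, the
   p_j being distinct odd primes.  A closed interval of integer length 2L
   centred at x contains (ignoring boundaries) the 2L integers around x, so the
   average of f over Q(x, L) is a product over i of
   t_i #(multiples of t_i among 2L consecutive integers) / 2L.
   The radii L_j are chosen with p_k | 2 L_j exactly for k <> j: at radius L_j
   the coordinates outside block j contribute exactly 1, and those of block j
   contribute independent, bounded, nonconstant variables of mean 1.  Once
   block j is long enough for the second moment of their product W_j to be of
   order a (a large), a third-moment argument gives P(W_j >= a) >= q(a) > 0
   with q(a)
   independent of j.  The N events live on disjoint blocks, hence are
   independent, so their union has probability at least 1 - (1 - q(a))^N >= 1/2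
   for N large, and the weak type constant is at least about a/2. *)

(** * Multiples in a window of consecutive integers *)

Definition cnt (t e n : nat) : nat := (\sum_(q < n) (t %| e + q))%N.

Lemma cntD t e m n : cnt t e (m + n) = (cnt t e m + cnt t (e + m) n)%N.
Proof.
rewrite /cnt big_split_ord /=; congr addn.
by apply: eq_bigr => i _; rewrite addnA.
Qed.

Lemma cnt_shift t e s n : (t %| s)%N -> cnt t (s + e) n = cnt t e n.
Proof. by move=> ts; apply: eq_bigr => i _; rewrite -addnA dvdn_addr. Qed.

Lemma cnt_one_period t e : (0 < t)%N -> cnt t e t = 1%N.
Proof.
move=> t0; elim: e => [|e IH].
  rewrite /cnt (bigD1 (Ordinal t0)) //= dvdn0 big1 ?addn0 // => i.
  rewrite -val_eqE /= add0n => i0; rewrite gtnNdvd // lt0n //.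
(* Slide the window by one: the integer [e] that it loses and the integer [e + t] that it gains are
   multiples of [t] together. *)
have H : cnt t e (t + 1) = cnt t e (1 + t) by rewrite addnC.
move: H; rewrite !cntD IH addn1 [cnt t (e + t) 1]/cnt [cnt t e 1]/cnt !big_ord1 !addn0 dvdn_addl //; lia.
Qed.

Lemma cnt_periods t e m : (0 < t)%N -> cnt t e (t * m) = m.
Proof.
move=> t0; elim: m e => [|m IH] e; first by rewrite muln0 /cnt big_ord0.
by rewrite mulnS cntD cnt_one_period // IH.
Qed.

Lemma cnt_leq_window t e m n : (m <= n)%N -> (cnt t e m <= cnt t e n)%N.
Proof. by move=> /subnKC <-; rewrite cntD leq_addr. Qed.

(** Completing the window to whole periods gives length at most [n + t <= 2 * n]. This is the source
    of the uniform bound 2 in the third-moment estimate. *)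
Lemma cnt_mul_le t e n : (0 < t)%N -> (t <= n)%N -> (t * cnt t e n <= 2 * n)%N.
Proof.
move=> t0 tn; have H : (n <= t * (n %/ t).+1)%N by rewrite mulnC ltnW // ltn_ceil.
have := cnt_leq_window t e H; rewrite cnt_periods // => H2.
have := leq_mul (leqnn t) H2; rewrite mulnS [(t * (_ %/ _))%N]mulnC.
have := leq_divM n t; lia.
Qed.

(** * Uniform averages on finite types *)

Section Average.
Variable R : archiRealFieldType.
Implicit Types T I J : finType.

Definition avg T (F : T -> R) : R := (#|T|%:R)^-1 * \sum_x F x.

Lemma eq_avg T (F G : T -> R) : F =1 G -> avg F = avg G.
Proof. by move=> FG; rewrite /avg (eq_bigr G). Qed.

Lemma le_avg T (F G : T -> R) : (forall x, F x <= G x) -> avg F <= avg G.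
Proof.
by move=> FG; rewrite /avg ler_wpM2l ?invr_ge0 ?ler0n // ler_sum.
Qed.

Lemma avgD T (F G : T -> R) : avg (fun x => F x + G x) = avg F + avg G.
Proof. by rewrite /avg big_split mulrDr. Qed.

Lemma avgZ T c (F : T -> R) : avg (fun x => c * F x) = c * avg F.
Proof. by rewrite /avg -mulr_sumr mulrCA. Qed.

Lemma avg_cst T c : (0 < #|T|)%N -> avg (fun _ : T => c) = c.
Proof.
move=> T0; rewrite /avg sumr_const -[c *+ _]mulr_natl mulrA mulVf ?mul1r //.
by rewrite pnatr_eq0 -lt0n.
Qed.

(** Independence of the coordinates: padding with the constant 1 outside [A] lets the product and
    the sum be interchanged. *)
Lemma avg_prod I J (A : {set I}) (g : J -> R) : (0 < #|J|)%N ->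
  avg (fun x : {ffun I -> J} => \prod_(i in A) g (x i)) = avg g ^+ #|A|.
Proof.
move=> J0; pose G i j := if i \in A then g j else 1.
rewrite /avg (eq_bigr (fun x : {ffun I -> J} => \prod_i G i (x i))); last first.
  by move=> x _; rewrite big_mkcond.
rewrite -(bigA_distr_bigA G) card_ffun natrX.
have -> : \prod_i \sum_j G i j = \prod_i (#|J|%:R * (if i \in A then avg g else 1)).
  apply: eq_bigr => i _; rewrite /G /avg; case: ifP => _.
    by rewrite mulrA mulfV ?mul1r // pnatr_eq0 -lt0n.
  by rewrite sumr_const mulr1.
rewrite big_split /= prodr_const -big_mkcond prodr_const mulrA mulVf ?mul1r //.
by rewrite expf_neq0 // pnatr_eq0 -lt0n.
Qed.

(* Swapping the coordinates outside [A] of two points is an involution that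
   turns F(x) G(y) into F(u) G(u). *)
Lemma avg_indep I J (A : {set I}) (F G : {ffun I -> J} -> R) : (0 < #|J|)%N ->
  (forall x y : {ffun I -> J}, (forall i, i \in A -> x i = y i) -> F x = F y) ->
  (forall x y : {ffun I -> J}, (forall i, i \notin A -> x i = y i) -> G x = G y) ->
  avg (fun x => F x * G x) = avg F * avg G.
Proof.
move=> J0 HF HG.
pose mix (x y : {ffun I -> J}) := [ffun i => if i \in A then x i else y i].
pose sw (p : {ffun I -> J} * {ffun I -> J}) := (mix p.1 p.2, mix p.2 p.1).
have swK : involutive sw.
  by move=> [x y]; rewrite /sw /=; congr (_, _); apply/ffunP => i; rewrite !ffunE; case: (i \in A).
have N0 : (#|{ffun I -> J}|%:R : R) != 0.
  by rewrite pnatr_eq0 card_ffun expn_eq0 negb_and -lt0n J0.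
have H : (\sum_x F x) * (\sum_x G x) = #|{ffun I -> J}|%:R * \sum_x F x * G x.
  rewrite big_distrlr /= pair_big /= (reindex_inj (inv_inj swK)) /=.
  rewrite (eq_bigr (fun p : {ffun I -> J} * {ffun I -> J} => F p.1 * G p.1)).
    rewrite -(pair_big xpredT xpredT (fun x (_ : {ffun I -> J}) => F x * G x)) /=.
    rewrite exchange_big /= sumr_const mulr_natl; reflexivity.
  move=> [x y] _ /=; congr (_ * _).
    by apply: HF => i iA; rewrite ffunE iA.
  by apply: HG => i /negPf iA; rewrite ffunE iA.
rewrite /avg mulrACA H mulrA mulfVK // .
Qed.

Lemma avg_indep_prod (N : nat) I J (lab : I -> nat) (F : nat -> {ffun I -> J} -> R) :
  (0 < #|J|)%N ->
  (forall j (x y : {ffun I -> J}), (forall i, lab i = j -> x i = y i) -> F j x = F j y) ->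
  avg (fun x => \prod_(j < N) F j x) = \prod_(j < N) avg (F j).
Proof.
move=> J0 HF; elim: N => [|N IH].
  rewrite big_ord0 -[RHS](avg_cst _ (T := {ffun I -> J})) ?card_ffun ?expn_gt0 ?J0 //.
  by apply: eq_avg => x; rewrite big_ord0.
(* The first [N] factors depend only on the coordinates outside block [N], the last one only on
   those inside. *)
rewrite big_ord_recr /= -IH -(@avg_indep _ _ [set i | lab i != N]) //.
- by apply: eq_avg => x; rewrite big_ord_recr.
- move=> x y xy; apply: eq_bigr => j _; apply: HF => i ij; apply: xy.
  by rewrite inE ij neq_ltn ltn_ord.
- move=> x y xy; apply: HF => i ij; apply: xy; by rewrite inE ij eqxx.
Qed.

(* Third-moment substitute for the central limit theorem: integrate the cubic
   (w - a) w (B - w), which is nonpositive on [0, a] and beyond B. *)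
Lemma avg_tail_ge T (X : T -> R) (a : R) : 1 <= a -> (0 < #|T|)%N ->
  (forall x, 0 <= X x) -> avg X = 1 -> 2 * a <= avg (fun x => X x ^+ 2) ->
  avg (fun x => X x ^+ 3) <= (4 * a) ^+ 4 ->
  2 * a ^+ 2 / (256 * a ^+ 3) ^+ 3 <= avg (fun x => (a <= X x)%R%:R).
Proof.
(* [B] solves [(4 * a) ^+ 4 = B * a], so the mean of the cubic is at least [2 * a * (a + B) - a * B
   - B * a = 2 * a ^+ 2]. *)
move=> a1 T0 X0 m1 m2 m3; set B := 256 * a ^+ 3.
have aB : a <= B.
  rewrite /B; have : 1 <= a ^+ 2 by rewrite expr_ge1 // (le_trans _ a1).
  by move=> a2; rewrite exprS; nra.
have B0 : 0 < B by apply: lt_le_trans aB; lra.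
pose Q x := (a + B) * (X x ^+ 2) + ((- (a * B)) * X x + (- 1) * (X x ^+ 3)).
have HQ : avg Q >= 2 * a ^+ 2.
  rewrite /Q !avgD !avgZ m1; set u := avg _ in m2 *; set v := avg _ in m3 *.
  have E : (4 * a) ^+ 4 = B * a by rewrite /B; ring.
  rewrite E in m3.
  nra.
rewrite ler_pdivrMr ?exprn_gt0 // [avg _ * _]mulrC -avgZ.
(* On [[a, B]] each of the three factors of [Q] is at most [B], so [Q] is at most [B ^+ 3] there. *)
apply: le_trans HQ _; apply: le_avg => x; rewrite /Q.
have -> : (a + B) * X x ^+ 2 + (- (a * B) * X x + -1 * X x ^+ 3) =
   (X x - a) * X x * (B - X x) by ring.
have x0 := X0 x; case: (leP a (X x)) => ax; last first.
  rewrite mulr0; apply: mulr_le0_ge0; last by lra.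
  by apply: mulr_le0_ge0 => //; lra.
rewrite mulr1; case: (leP (X x) B) => xB; last first.
  apply: (@le_trans _ _ 0); last by rewrite exprn_ge0 // ltW.
  by apply: mulr_ge0_le0; [apply: mulr_ge0 => //; lra | lra].
rewrite exprSr expr2; apply: ler_pM; rewrite ?mulr_ge0 //; try lra.
by apply: ler_pM => //; lra.
Qed.

(** By independence, moments of the product are powers of moments of [V]. As [V <= 2], the
    inequality [(V - 1)^2 (2 - V) >= 0] bounds [V^3] by [4 V^2 - 5 V + 2], of mean
    [1 + 4 v <= (1 + v)^4]. So the third moment of the product is at most the fourth power of its
    second moment. *)
Lemma avg_block_ge I J (A : {set I}) (V : J -> R) (a v : R) : 1 <= a -> (0 < #|J|)%N ->
  (forall x, 0 <= V x <= 2) -> avg V = 1 -> avg (fun x => V x ^+ 2) = 1 + v ->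
  2 * a <= (1 + v) ^+ #|A| <= 4 * a ->
  2 * a ^+ 2 / (256 * a ^+ 3) ^+ 3 <=
    avg (fun x : {ffun I -> J} => (a <= \prod_(i in A) V (x i))%R%:R).
Proof.
move=> a1 J0 V02 m1 m2 /andP[lo hi].
have X k : avg (fun x : {ffun I -> J} => (\prod_(i in A) V (x i)) ^+ k) =
    avg (fun x => V x ^+ k) ^+ #|A|.
  by rewrite -avg_prod //; apply: eq_avg => x; rewrite prodrXl.
have v0 : 0 <= v.
  have : 0 <= avg (fun x => V x ^+ 2 + ((-2) * V x + 1)).
    rewrite -[0](avg_cst _ J0); apply: le_avg => x.
    have -> : V x ^+ 2 + (-2 * V x + 1) = (V x - 1) ^+ 2 by ring.
    exact: sqr_ge0.
  by rewrite !avgD avgZ avg_cst // m1 m2; lra.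
apply: avg_tail_ge => //.
- by rewrite card_ffun expn_gt0 J0.
- by move=> x; apply: prodr_ge0 => i _; case/andP: (V02 (x i)).
- by rewrite avg_prod // m1 expr1n.
- by rewrite X m2.
rewrite X; apply: (@le_trans _ _ (((1 + v) ^+ 4) ^+ #|A|)); last first.
  by rewrite -exprM mulnC exprM lerXn2r // nnegrE ?exprn_ge0 //; lra.
have m30 : 0 <= avg (fun x => V x ^+ 3).
  rewrite -[0](avg_cst _ J0); apply: le_avg => x.
  by rewrite exprn_ge0 //; case/andP: (V02 x).
rewrite lerXn2r ?nnegrE ?exprn_ge0 //; first by lra.
apply: (@le_trans _ _ (1 + 4 * v)); last first.
  have -> : (1 + v) ^+ 4 = 1 + 4 * v + v ^+ 2 * (6 + 4 * v + v ^+ 2) by ring.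
  by rewrite lerDl mulr_ge0 ?sqr_ge0 // addr_ge0 ?sqr_ge0 //; lra.
apply: (@le_trans _ _ (avg (fun x => 4 * V x ^+ 2 + ((-5) * V x + 2)))).
  apply: le_avg => x; have /andP[? ?] := V02 x; rewrite -subr_ge0.
  have -> : 4 * V x ^+ 2 + (-5 * V x + 2) - V x ^+ 3 = (V x - 1) ^+ 2 * (2 - V x) by ring.
  by rewrite mulr_ge0 ?sqr_ge0 //; lra.
by rewrite !avgD !avgZ avg_cst // m1 m2; lra.
Qed.

End Average.

(** * The discrete model *)

Lemma exists_distinct_odd_primes :
  exists p : nat -> nat, (forall j, prime (p j) && (2 < p j)%N) /\ injective p.
Proof.
pose p := fix p j := s2val (prime_above (if j is j'.+1 then p j' else 2)).
have pS j : (p j < p j.+1)%N by rewrite /=; case: (prime_above (p j)).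
have inc j k : (j < k)%N -> (p j < p k)%N.
  elim: k => // k IH; rewrite ltnS leq_eqVlt => /orP[/eqP ->|/IH H]; first exact: pS.
  exact: ltn_trans H (pS k).
have p2 j : (2 < p j)%N.
  have p0 : (2 < p 0)%N by rewrite /=; case: (prime_above 2).
  by case: j => // j; apply: ltn_trans p0 (inc _ _ _).
exists p; split.
  by move=> j; rewrite p2 andbT; case: j => [|j] /=; case: prime_above.
move=> j k pjk; case: (ltngtP j k) => // /inc; rewrite pjk ltnn //.
Qed.

Lemma card_ord_range d a b : (b <= d)%N -> #|[set i : 'I_d | (a <= i < b)%N]| = (b - a)%N.
Proof.
move=> bd; rewrite -sum1dep_card -(big_mkord (fun i => (a <= i < b)%N) (fun=> 1%N)).
rewrite -[RHS]muln1 -sum_nat_const_nat [RHS](big_nat_widenl _ 0) // [RHS](big_nat_widen _ _ d) //.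
Qed.

(** The blocks are consecutive intervals cut at the partial sums of [n]; labels from [N] on mark the
    coordinates outside all blocks, so one labelling serves every large [d]. *)
Lemma exists_labelling (n : nat -> nat) N : exists lab : nat -> nat,
  forall d j, (j < N)%N -> (\sum_(k < N) n k <= d)%N -> #|[set i : 'I_d | lab i == j]| = n j.
Proof.
pose s j := (\sum_(k < j) n k)%N.
have sS j : s j.+1 = (s j + n j)%N by rewrite /s big_ord_recr.
have sM : {homo s : i j / (i <= j)%N}.
  apply: homo_leq => [//|y x z|i]; [exact: leq_trans|by rewrite sS leq_addr].
suff [lab [_ H]] : exists lab : nat -> nat, (forall i, (lab i < N)%N = (i < s N)%N) /\
    forall i j, (j < N)%N -> (lab i == j) = (s j <= i < s j.+1)%N.
  exists lab => d j jN sd; transitivity #|[set i : 'I_d | (s j <= i < s j.+1)%N]|.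
    by apply: eq_card => i; rewrite !inE H.
  by rewrite card_ord_range ?sS ?addKn // -sS (leq_trans _ sd) //; apply: sM.
elim: N => [|N [lab [H1 H2]]]; first by exists id; split => // i; rewrite /s big_ord0 ltn0.
exists (fun i => if i < s N then lab i else if i < s N.+1 then N else N.+1)%N; split.
  move=> i; have := H1 i; have := sM _ _ (leqnSn N); case: (ltnP i (s N)) => h1 h2 h3; first lia.
  by case: (ltnP i (s N.+1)); lia.
move=> i j; rewrite ltnS leq_eqVlt; have := H1 i; case: (ltnP i (s N)) => iN lN /orP[/eqP ->|jN].
- by lia.
- exact: H2.
- by case: ltnP => iN1; lia.
- have := sM _ _ jN; case: ltnP => ?; lia.
Qed.

(** * Normalized counts of multiples and choice of the parameters *)

Section Discrete.
Variable R : archiRealFieldType.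

Definition ratio (t e n : nat) : R := (t * cnt t e n)%:R / n%:R.

Lemma ratio_exact t e n : (0 < n)%N -> (t %| n)%N -> ratio t e n = 1.
Proof.
move=> n0 /dvdnP[m mE]; have t0 : (0 < t)%N by move: n0; rewrite mE; case: t {mE} => //; rewrite muln0.
rewrite /ratio mE mulnC [(m * t)%N]mulnC cnt_periods // [(m * t)%N]mulnC divff //.
by rewrite pnatr_eq0 -lt0n [(t * m)%N]mulnC -mE.
Qed.

Lemma ratio_bounds t e n : (0 < t)%N -> (t <= n)%N -> 0 <= ratio t e n <= 2.
Proof.
move=> t0 tn; have n0 : (0 < n)%N by lia.
rewrite divr_ge0 ?ler0n //= ler_pdivrMr ?ltr0n // -natrM ler_nat.
exact: cnt_mul_le.
Qed.

(** Ratio 1 would exhibit [n] as a multiple of [t]. This makes the variances strictly positive. *)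
Lemma ratio_neq1 t e n : (0 < n)%N -> ~~ (t %| n)%N -> ratio t e n != 1.
Proof.
move=> n0; apply: contra; rewrite /ratio => /eqP H.
have : (t * cnt t e n)%:R = n%:R :> R by rewrite -[LHS](@divfK _ n%:R) ?H ?mul1r // pnatr_eq0 -lt0n.
by move/eqP; rewrite eqr_nat => /eqP <-; rewrite dvdn_mulr.
Qed.

Lemma ratio_shift t e s n : (t %| s)%N -> ratio t (s + e) n = ratio t e n.
Proof. by move=> ts; rewrite /ratio cnt_shift. Qed.

(** Double counting: each position in the window meets a multiple of [t] for exactly [P %/ t] of the
    [P] starting points. *)
Lemma avg_ratio t e n P : (0 < P)%N -> (0 < n)%N -> (t %| P)%N ->
  avg (fun k : 'I_P => ratio t (k + e) n) = 1.
Proof.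
move=> P0 n0 tP; have t0 : (0 < t)%N by apply: dvdn_gt0 tP.
rewrite /avg /ratio -mulr_suml card_ord.
have -> : \sum_(k < P) ((t * cnt t (k + e) n)%:R : R) = (P * n)%:R.
  rewrite -natr_sum -big_distrr /= /cnt exchange_big /= (eq_bigr (fun=> P %/ t)%N).
    rewrite sum_nat_const card_ord mulnCA -[in RHS](divnK tP); congr _%:R; lia.
  move=> q _; rewrite -(@cnt_periods t (e + q) (P %/ t) t0) mulnC divnK //.
  by apply: eq_bigr => k _; congr (nat_of_bool (dvdn _ _)); lia.
by rewrite natrM mulrA mulKf ?divff // pnatr_eq0 -lt0n.
Qed.

(** Frees the moments of one coordinate from the factor [K], which will depend on the dimension. *)
Lemma avg_periodic (g : nat -> R) K P : (0 < K)%N -> (forall i, g (P + i)%N = g i) ->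
  avg (fun k : 'I_(K * P) => g k) = avg (fun k : 'I_P => g k).
Proof.
move=> K0 gP; rewrite /avg !card_ord.
have -> : \sum_(k < K * P) g k = K%:R * \sum_(k < P) g k.
  elim: K {K0} => [|K IH]; first by rewrite mul0n big_ord0 mul0r.
  rewrite mulSn big_split_ord /= -addn1 natrD mulrDl mul1r addrC; congr +%R.
  by rewrite -IH; apply: eq_bigr => i _; rewrite gP.
rewrite natrM invfM mulrACA mulVf ?mul1r // pnatr_eq0 -lt0n //.
Qed.

(** The least exponent reaching [2 * a] works: since [1 + v <= 2], the last step at most doubles the
    power. Bernoulli's inequality gives existence. *)
Lemma exists_expr_between (v a : R) : 0 < v <= 1 -> 1 <= a ->
  exists n, 2 * a <= (1 + v) ^+ n <= 4 * a.
Proof.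
move=> /andP[v0 v1] a1.
have ber m : 1 + m%:R * v <= (1 + v) ^+ m.
  elim: m => [|m IH]; first by rewrite mul0r addr0.
  rewrite exprS -addn1 natrD; have : 0 <= m%:R * v ^+ 2 by rewrite mulr_ge0 ?sqr_ge0.
  by nra.
have ex : exists n, 2 * a <= (1 + v) ^+ n.
  exists (Num.bound (2 * a / v)); apply: le_trans (ber _).
  have /archi_boundP : 0 <= 2 * a / v by rewrite divr_ge0 //; lra.
  by rewrite ltr_pdivrMr //; lra.
case: (ex_minnP ex) => n nP nmin; exists n; rewrite nP /=.
case: n nP nmin => [|n] nP nmin; first by rewrite expr0; lra.
have : (1 + v) ^+ n < 2 * a.
  by rewrite ltNge; apply/negP => /nmin; rewrite ltnn.
have : 0 <= (1 + v) ^+ n by rewrite exprn_ge0 //; lra.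
by rewrite exprS; nra.
Qed.

Lemma exists_expr_le_half (p : R) : 0 < p -> p <= 1 -> exists N, (1 - p) ^+ N <= 2^-1.
Proof.
(* With [a = 1] this gives [(1 + p) ^+ n >= 2], and [(1 - p) * (1 + p) <= 1]. *)
move=> p0 p1; have [|n /andP[H _]] := @exists_expr_between p 1 _ (lexx 1); first by rewrite p0.
exists n; have : (1 - p) ^+ n * (1 + p) ^+ n <= 1.
  rewrite -exprMn; apply: exprn_ile1; first by apply: mulr_ge0; lra.
  by have : 0 <= p ^+ 2 := sqr_ge0 p; nra.
have : 0 <= (1 - p) ^+ n by rewrite exprn_ge0 //; lra.
by nra.
Qed.

(* The periods [p j] divide the window lengths [2 * L k] exactly when [j != k],
   so at radius [L j] only the coordinates of block [j] fluctuate. *)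
Lemma exists_periods N : exists p L : nat -> nat,
  [/\ forall j, (0 < p j)%N, forall j, (0 < L j)%N, forall j, (p j <= 2 * L j)%N,
      forall j k, (j < N)%N -> j != k -> (p j %| 2 * L k)%N &
      forall j, ~~ (p j %| 2 * L j)%N].
Proof.
have [p [pP pI]] := exists_distinct_odd_primes.
have pr j : prime (p j) by case/andP: (pP j).
have p0 j : (0 < p j)%N := prime_gt0 (pr j).
(* The power of 2 only serves to make [p j <= 2 * L j]; as [p j] is odd, it creates no
   divisibility. *)
exists p, (fun j => 2 ^ p j * \prod_(k < N | k != j :> nat) p k)%N.
have M0 j : (0 < \prod_(k < N | k != j :> nat) p k)%N by apply: prodn_gt0.
split=> // [j|j|j k jN jk|j].
- by rewrite muln_gt0 expn_gt0 M0.
- by have := ltn_expl (p j) (isT : (1 < 2)%N); have := M0 j; nia.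
- rewrite (bigD1 (Ordinal jN)) //= mulnA mulnCA dvdn_mulr //.
- rewrite mulnA -expnS Euclid_dvdM // Euclid_dvdX // andbT negb_or.
  rewrite gtnNdvd //=; last by case/andP: (pP j).
  rewrite big_seq_cond; apply: (big_ind (fun m => ~~ (p j %| m)%N)).
  + by rewrite dvdn1; have := prime_gt1 (pr j); lia.
  + by move=> x y hx hy; rewrite Euclid_dvdM // negb_or hx.
  + move=> k /andP[_ kj]; rewrite dvdn_prime2 //; apply: contra kj => /eqP /pI -> //.
Qed.

(** [D], [P0] and the radii depend on [a] alone. The window from [x i + (P0 + 1 - L)] holds the
    [2 * L] integers nearest to the cell between [P0 + x i] and [P0 + x i + 1]; [L <= P0] keeps the
    subtraction from truncating. *)
Lemma half_cells_have_large_average (a : R) : 1 <= a ->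
  exists (D P0 : nat) (Ls : seq nat), (0 < P0)%N /\ (forall L, L \in Ls -> (0 < L <= P0)%N) /\
  forall d, (D <= d)%N -> exists t : 'I_d -> nat, (forall i, (0 < t i)%N && (t i %| P0)%N) /\
  forall K, (0 < K)%N ->
    2^-1 <= avg (fun x : {ffun 'I_d -> 'I_(K * P0)} =>
      (has (fun L => a <= \prod_i ratio (t i) (x i + (P0 + 1 - L)) (2 * L))%R Ls)%:R : R).
Proof.
move=> a1; pose q : R := 2 * a ^+ 2 / (256 * a ^+ 3) ^+ 3.
have a0 : 0 < a by lra.
have q0 : 0 < q by rewrite /q divr_gt0 ?exprn_gt0 ?mulr_gt0 ?exprn_gt0.
have q1 : q <= 1.
  rewrite /q ler_pdivrMr ?exprn_gt0 ?mulr_gt0 ?exprn_gt0 // mul1r.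
  have -> : (256 * a ^+ 3) ^+ 3 = 256 ^+ 3 * a ^+ 7 * a ^+ 2 by ring.
  rewrite ler_pM2r ?exprn_gt0 //; have : 1 <= a ^+ 7 by rewrite exprn_ege1.
  lra.
have [N qN] := exists_expr_le_half q0 q1.
have [p [L [p0 L0 pL dvd ndvd]]] := exists_periods N.
(* A common multiple of the [p j], hence a period of every [V j], that also dominates every
   [L j]. *)
pose P0 := ((\prod_(j < N) p j) * (\prod_(j < N) L j))%N.
have P00 : (0 < P0)%N by rewrite muln_gt0 !prodn_gt0.
have pP j : (j < N)%N -> (p j %| P0)%N.
  by move=> jN; rewrite /P0 (bigD1 (Ordinal jN)) //= -mulnA dvdn_mulr.
have LP j : (j < N)%N -> (L j <= P0)%N.
  move=> jN; apply: dvdn_leq => //.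
  by rewrite /P0 [X in (_ * X)%N](bigD1 (Ordinal jN)) //= mulnCA dvdn_mulr.
pose V j k : R := ratio (p j) (k + (P0 + 1 - L j)) (2 * L j).
have VP j k : (j < N)%N -> V j (P0 + k)%N = V j k.
  by move=> jN; rewrite /V -addnA ratio_shift // pP.
have V02 j k : 0 <= V j k <= 2 by rewrite ratio_bounds.
have V1 j : (j < N)%N -> avg (fun k : 'I_P0 => V j k) = 1.
  by move=> jN; apply: avg_ratio; rewrite ?pP // muln_gt0 L0.
pose v j := avg (fun k : 'I_P0 => V j k ^+ 2) - 1.
have v01 j : (j < N)%N -> 0 < v j <= 1.
  (* [v j] is a variance: positive because [V j] never equals 1, at most 1 because [V j] takes
     values in [[0, 2]]. *)
  move=> jN; have E : v j = avg (fun k : 'I_P0 => (V j k - 1) ^+ 2).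
    have -> : avg (fun k : 'I_P0 => (V j k - 1) ^+ 2) =
        avg (fun k : 'I_P0 => V j k ^+ 2 + ((- 2) * V j k + 1)).
      by apply: eq_avg => k; ring.
    rewrite !avgD avgZ avg_cst ?card_ord // V1 // /v; congr +%R; lra.
  rewrite E; apply/andP; split.
    rewrite /avg mulr_gt0 ?invr_gt0 ?ltr0n ?card_ord //.
    rewrite (bigD1 (Ordinal P00)) //= ltr_wpDr ?sumr_ge0 // => [k _|]; first exact: sqr_ge0.
    by rewrite exprn_even_gt0 //= subr_eq0 ratio_neq1 // muln_gt0 L0.
  rewrite -[X in _ <= X](@avg_cst R 'I_P0) ?card_ord //; apply: le_avg => k.
  have := V02 j k; move: (V j k) => u /andP[u0 u2]; rewrite -subr_ge0 /=.
  have -> : 1 - (u - 1) ^+ 2 = u * (2 - u) by ring.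
  by rewrite mulr_ge0 ?subr_ge0.
have /fin_all_exists [n nP] : forall j : 'I_N, exists n, 2 * a <= (1 + v j) ^+ n <= 4 * a.
  by move=> j; apply: exists_expr_between => //; apply: v01.
pose n' j := if insub j is Some i then n i else 0%N.
have n'E (j : 'I_N) : n' j = n j by rewrite /n' valK.
have [lab labP] := exists_labelling n' N.
exists (\sum_(j < N) n' j)%N, P0, [seq L j | j <- iota 0 N]; split => //; split.
  by move=> _ /mapP[j + ->]; rewrite mem_iota L0 add0n /= => /LP.
move=> d dD; exists (fun i => if (lab i < N)%N then p (lab i) else 1%N); split.
  by move=> i; case: ifP => lN; rewrite ?dvd1n ?p0 ?pP.
move=> K K0.
pose A j := [set i : 'I_d | lab i == j].
pose W j (x : {ffun 'I_d -> 'I_(K * P0)}) := \prod_(i in A j) V j (x i).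
(* Indicator that block [j] fails; the product over [j] indicates that all blocks fail. *)
pose F j x : R := (W j x < a)%R%:R.
have KP0 : (0 < K * P0)%N by rewrite muln_gt0 K0.
have F1 j : (j < N)%N -> avg (F j) <= 1 - q.
  move=> jN; have -> : avg (F j) = avg (fun x => 1 + (- 1) * (a <= W j x)%R%:R).
    by apply: eq_avg => x; rewrite /F ltNge; case: (a <= _) => /=; ring.
  rewrite avgD avgZ avg_cst ?card_ffun ?expn_gt0 ?card_ord ?KP0 //.
  rewrite mulN1r lerD2l lerN2; apply: (@avg_block_ge _ _ _ (A j) (fun k : 'I_(K * P0) => V j k) a (v j)) => //.
  - by rewrite card_ord.
  - by rewrite (avg_periodic K0 (fun k => VP j k jN)) V1.
  - rewrite (@avg_periodic (fun k => V j k ^+ 2) _ _ K0) ?/v; first by lra.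
    by move=> k; rewrite VP.
  - by rewrite labP // (n'E (Ordinal jN)) (nP (Ordinal jN)).
have F0 j x : 0 <= F j x by rewrite ler0n.
have : avg (fun x => \prod_(j < N) F j x) <= 2^-1.
  rewrite (@avg_indep_prod _ _ _ _ (fun i : 'I_d => lab i)) ?card_ord //; last first.
    move=> j x y xy; rewrite /F /W; congr (nat_of_bool (_ < _))%:R.
    by apply: eq_bigr => i; rewrite inE => /eqP /xy ->.
  apply: le_trans qN; rewrite -[X in _ ^+ X]card_ord -prodr_const.
  apply: ler_prod => j _; rewrite F1 // andbT.
  by rewrite /avg mulr_ge0 ?invr_ge0 ?sumr_ge0.
set G := avg _; set H := avg _ => HG.
suff : 1 <= G + H by lra.
rewrite /G /H -avgD -[X in X <= _](@avg_cst R {ffun 'I_d -> 'I_(K * P0)}); last first.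
  by rewrite card_ffun expn_gt0 card_ord KP0.
apply: le_avg => x; rewrite /=; case: (boolP (has _ _)) => [_|/hasPn hx]; first by rewrite mulr1n lerDr prodr_ge0.
rewrite mulr0n addr0 big1 // => j _; rewrite /F ltNge.
have /hx : L j \in [seq L j | j <- iota 0 N] by rewrite map_f // mem_iota /=.
(* At radius [L j] every coordinate outside block [j] contributes exactly 1. *)
suff -> : W j x = \prod_(i < d) ratio (if (lab i < N)%N then p (lab i) else 1)
    (x i + (P0 + 1 - L j)) (2 * L j) by move=> /negPf ->.
rewrite /W big_mkcond; apply: eq_bigr => i _; rewrite inE.
case: eqP => [->|/eqP lj]; first by rewrite ltn_ord.
rewrite ratio_exact // ?muln_gt0 ?L0 //; case: ifP => // lN; exact: dvd.
Qed.
End Discrete.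

Local Open Scope classical_set_scope.
Local Open Scope ring_scope.

(** * Maximal functions of sums of bumps *)

Section Cubes.
Variables (R : realType) (d : nat) (mu : {measure set (d.-tuple R) -> \bar R}).
Hypothesis hmu : is_lebesgue_measure mu.
Implicit Types (x y : d.-tuple R) (r s : R).

Lemma measurable_box (a b : d.-tuple R) : measurable (box a b).
Proof.
have -> : box a b = \bigcap_(i : 'I_d)
    ((fun y : d.-tuple R => tnth y i) @^-1` `[tnth a i, tnth b i]).
  apply/seteqP; split => y /= H i; last by have := H i I; rewrite /= in_itv.
  by move=> _; rewrite /= in_itv /= H.
apply: fin_bigcap_measurable => [|i _]; first exact: finite_finset.
rewrite -[X in measurable X]setTI; exact: measurable_tnth.
Qed.

Lemma cube_box x r : cube x r =
  box [tuple tnth x i - r | i < d] [tuple tnth x i + r | i < d].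
Proof.
apply/seteqP; split => y /= H i; have := H i;
  by rewrite ?tnth_mktuple ler_distl.
Qed.

Lemma measurable_cube x r : measurable (cube x r).
Proof. by rewrite cube_box; exact: measurable_box. Qed.

Lemma mu_cube x r : 0 <= r -> mu (cube x r) = ((2 * r) ^+ d)%:E.
Proof.
move=> r0; rewrite cube_box hmu; last by move=> i; rewrite !tnth_mktuple; lra.
rewrite -[in RHS](card_ord d) -prodr_const; congr EFin; apply: eq_bigr => i _.
rewrite !tnth_mktuple; ring.
Qed.

Definition overlap x r y s : R := \prod_(i < d)
  Num.max 0 (Num.min (tnth x i + r) (tnth y i + s) - Num.max (tnth x i - r) (tnth y i - s)).

Lemma mu_cubeI x r y s : mu (cube x r `&` cube y s) = (overlap x r y s)%:E.
Proof.
pose a := [tuple Num.max (tnth x i - r) (tnth y i - s) | i < d].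
pose b := [tuple Num.min (tnth x i + r) (tnth y i + s) | i < d].
have -> : cube x r `&` cube y s = box a b.
  rewrite !cube_box; apply/seteqP; split => z /=.
    move=> [H1 H2] i; have := H1 i; have := H2 i; rewrite !tnth_mktuple.
    by rewrite ge_max le_min => /andP[-> ->] /andP[-> ->].
  by move=> H; split=> i; have := H i; rewrite !tnth_mktuple ge_max le_min;
    move=> /andP[/andP[? ?] /andP[? ?]]; apply/andP.
have [ab|] := pselect (forall i, tnth a i <= tnth b i).
  rewrite hmu //; congr EFin; apply: eq_bigr => i _; have := ab i.
  by rewrite !tnth_mktuple => abi; rewrite [Num.max 0 _]max_r ?subr_ge0.
move=> /existsNP[i /negP abi].
have -> : box a b = set0.
  apply/seteqP; split => // z /(_ i) /andP[h1 h2].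
  by move: abi; rewrite (le_trans h1 h2).
rewrite measure0 /overlap (bigD1 i) //= max_l ?mul0r //.
by move: abi; rewrite -ltNge !tnth_mktuple => /ltW; rewrite subr_le0.
Qed.

Lemma measurable_overlap y r s : measurable_fun setT (fun x => overlap x r y s).
Proof.
apply: measurable_prod => i _; apply: measurable_maxr => //.
apply: measurable_funB.
  by apply: measurable_minr => //; apply: measurable_funD => //; exact: measurable_tnth.
by apply: measurable_maxr => //; apply: measurable_funB => //; exact: measurable_tnth.
Qed.

(** * Sums of bumps and measurability of their maximal function *)

Section Bumps.
Variables (I : finType) (w : I -> R) (c : I -> d.-tuple R) (s : R).
Hypotheses (w0 : forall k, 0 <= w k) (s0 : 0 <= s).

Definition bumps (y : d.-tuple R) : R := \sum_k w k * \1_(cube (c k) s) y.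

Definition bump_mass x r : R := \sum_k w k * overlap x r (c k) s.

Lemma bumps_ge0 y : 0 <= bumps y.
Proof. by apply: sumr_ge0 => k _; rewrite mulr_ge0. Qed.

Lemma integral_bumps D : measurable D ->
  (\int[mu]_(y in D) (`|bumps y|)%:E = \sum_k (w k)%:E * mu (cube (c k) s `&` D))%E.
Proof.
move=> mD; under eq_integral do rewrite ger0_norm ?bumps_ge0 // /bumps -sumEFin.
have m1 k : measurable_fun D (fun y => (\1_(cube (c k) s) y)%:E : \bar R).
  by apply/measurable_EFinP; apply: measurable_indic; exact: measurable_cube.
under eq_integral do under eq_bigr do rewrite EFinM.
rewrite ge0_integral_sum //.
- apply: eq_bigr => k _; rewrite ge0_integralZl ?lee_fin // integral_indic //.
  exact: measurable_cube.
- by move=> k; apply: measurable_funeM.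
- by move=> k y _; rewrite mule_ge0 ?lee_fin.
Qed.

Lemma integral_bumps_cube x r :
  (\int[mu]_(y in cube x r) (`|bumps y|)%:E)%E = (bump_mass x r)%:E.
Proof.
rewrite integral_bumps; last exact: measurable_cube.
rewrite /bump_mass -sumEFin; apply: eq_bigr => k _.
by rewrite setIC mu_cubeI EFinM.
Qed.

Lemma integral_bumpsT :
  (\int[mu]_y (`|bumps y|)%:E)%E = ((2 * s) ^+ d * \sum_k w k)%:E.
Proof.
rewrite integral_bumps // mulr_sumr -sumEFin; apply: eq_bigr => k _.
by rewrite setIT mu_cube // -EFinM mulrC.
Qed.

Lemma measurable_bumps : measurable_fun setT bumps.
Proof.
apply: measurable_sum => k; apply: measurable_funM => //.
by apply: measurable_indic; exact: measurable_cube.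
Qed.

Lemma integrable_bumps : mu.-integrable setT (fun y => (bumps y)%:E).
Proof.
apply/integrableP; split; first by apply/measurable_EFinP; exact: measurable_bumps.
by under eq_integral do rewrite abse_EFin; rewrite integral_bumpsT ltry.
Qed.

Lemma bump_mass_le x r1 r2 : r1 <= r2 -> bump_mass x r1 <= bump_mass x r2.
Proof.
move=> r12; apply: ler_sum => k _; apply: ler_wpM2l => //.
apply: ler_prod => i _; rewrite le_max lexx /= ge_max !le_max lexx /=.
apply/orP; right; apply: lerB.
  by rewrite le_min !ge_min lexx orbT andbT lerD2l r12.
by rewrite ge_max !le_max lexx orbT andbT lerD2l lerN2 r12.
Qed.

Lemma measurable_bump_mass r : measurable_fun setT (fun x => bump_mass x r).
Proof.
by apply: measurable_sum => k; apply: measurable_funM => //; exact: measurable_overlap.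
Qed.

Lemma maximal_bumpsE x : maximal_fun mu bumps x =
  ereal_sup [set (((2 * r) ^+ d)^-1 * bump_mass x r)%:E | r in [set r : R | 0 < r]].
Proof.
rewrite /maximal_fun; congr ereal_sup; apply: eq_imagel => r /= r0.
by rewrite integral_bumps_cube mu_cube ?ltW.
Qed.

(** Reduces the supremum to countably many radii: the mass is nondecreasing in the radius and the
    volume is continuous, so a strict inequality survives at a slightly larger rational radius. *)
Lemma maximal_bumps_gt x (b : R) : (b%:E < maximal_fun mu bumps x)%E <->
  exists q : rat, 0 < (ratr q : R) /\ b < ((2 * ratr q) ^+ d)^-1 * bump_mass x (ratr q).
Proof.
rewrite maximal_bumpsE; split; last first.
  move=> [q [q0 bq]]; apply: (@lt_le_trans _ _ (((2 * ratr q) ^+ d)^-1 * bump_mass x (ratr q))%:E).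
    by rewrite lte_fin.
  by apply: ereal_sup_ubound; exists (ratr q).
move=> /ereal_sup_gt[_ [r /= r0 <-]]; rewrite lte_fin => br.
have cont : {for r, continuous (fun u : R => b * (2 * u) ^+ d)}.
  apply: continuousM; first exact: cst_continuous.
  apply: (@continuous_comp _ _ _ (fun u : R => 2 * u) (fun v : R => v ^+ d)); last exact: exprn_continuous.
  exact: mulrl_continuous.
have pw u : 0 < u -> 0 < (2 * u) ^+ d by move=> u0; rewrite exprn_gt0 ?mulr_gt0.
have lr : b * (2 * r) ^+ d < bump_mass x r.
  by move: br; rewrite mulrC ltr_pdivlMr ?pw.
have /nbhs_ballP[e /= e0 He] : \forall u \near r, b * (2 * u) ^+ d < bump_mass x r.
  exact: (cont _ (lt_nbhsl lr)).
have [q] := @rat_in_itvoo R r (r + e) (ltr_pwDr e0 (lexx r)).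
rewrite in_itv /= => /andP[rq qe]; have q0 := lt_trans r0 rq.
exists q; split => //; rewrite mulrC ltr_pdivlMr ?pw //.
apply: lt_le_trans (bump_mass_le x (ltW rq)); apply: He.
by rewrite /ball /= ltr_distlC; apply/andP; split; lra.
Qed.

Lemma measurable_maximal_bumps (a : R) :
  measurable [set x | (a%:E <= maximal_fun mu bumps x)%E].
Proof.
have mgt b : measurable [set x | (b%:E < maximal_fun mu bumps x)%E].
  have -> : [set x | (b%:E < maximal_fun mu bumps x)%E] =
    \bigcup_(q : rat) (if 0 < (ratr q : R) then
      [set x | b < ((2 * ratr q) ^+ d)^-1 * bump_mass x (ratr q)] else set0).
    apply/seteqP; split => x /=.
      by move=> /maximal_bumps_gt[q [q0 bq]]; exists q => //; rewrite q0.
    move=> [q _]; case: ifP => // q0 bq; apply/maximal_bumps_gt; by exists q.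
  apply: bigcupT_measurable_rat => q; case: ifP => // _.
  rewrite -[X in measurable X]setTI.
  have -> : [set x | b < ((2 * ratr q) ^+ d)^-1 * bump_mass x (ratr q)] =
    (fun x => ((2 * ratr q) ^+ d)^-1 * bump_mass x (ratr q)) @^-1` `]b, +oo[.
    by apply/seteqP; split => x /=; rewrite in_itv /= andbT.
  apply: measurable_funM => //; exact: measurable_bump_mass.
have -> : [set x | (a%:E <= maximal_fun mu bumps x)%E] =
  \bigcap_(n : nat) [set x | ((a - n.+1%:R^-1)%:E < maximal_fun mu bumps x)%E].
  apply/seteqP; split => x /=.
    by move=> ax n _ /=; apply: lt_le_trans ax; rewrite lte_fin ltrBlDr ltrDl.
  move=> H; apply/lee_addgt0Pr => e e0.
  have [n ne] : exists n : nat, n.+1%:R^-1 < e.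
    exists (Num.bound e^-1); rewrite invf_plt ?posrE //.
    have := @archi_boundP R e^-1; rewrite invr_ge0 ltW // => /(_ isT) /lt_le_trans; apply.
    by rewrite ler_nat.
  rewrite -leeBlDr //; have /= Hn := H n Logic.I; apply: ltW; apply: le_lt_trans Hn.
  by rewrite -EFinB lee_fin lerB // ltW.
exact: bigcapT_measurable.
Qed.

End Bumps.
End Cubes.

(** * From the discrete model to the weak type inequality *)

Section LowerBound.
Variables (R : realType) (d : nat) (mu : {measure set (d.-tuple R) -> \bar R}).
Hypothesis hmu : is_lebesgue_measure mu.

(** The boxes are unit cells shrunk by [s] on each side; [0 < s] makes these closed boxes
    disjoint. *)
Lemma mu_ge_cells n m (G : {set {ffun 'I_d -> 'I_n}}) (s : R) (S : set (d.-tuple R)) :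
  0 < s -> 2 * s <= 1 -> measurable S ->
  (forall k, k \in G -> box [tuple (m + k i)%:R + s | i < d]
                            [tuple (m + k i)%:R + 1 - s | i < d] `<=` S) ->
  ((#|G|%:R * (1 - 2 * s) ^+ d)%:E <= mu S)%E.
Proof.
move=> s0 s1 mS GS.
pose cell (k : {ffun 'I_d -> 'I_n}) : set (d.-tuple R) :=
  box [tuple (m + k i)%:R + s | i < d] [tuple (m + k i)%:R + 1 - s | i < d].
pose F (i : 'I_#|G|) := cell (enum_val i).
have mF i : measurable (F i) by exact: measurable_box.
have muF i : mu (F i) = ((1 - 2 * s) ^+ d)%:E.
  rewrite /F /cell hmu; last by move=> l; rewrite !tnth_mktuple; lra.
  rewrite -[in RHS](card_ord d) -prodr_const; congr EFin; apply: eq_bigr => l _.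
  by rewrite !tnth_mktuple; ring.
have tF : trivIset setT F.
  move=> i j _ _ [y [yi yj]]; apply: enum_val_inj; apply/ffunP => l; apply: val_inj.
  have := yi l; have := yj l; rewrite !tnth_mktuple !natrD.
  move=> /andP[a1 a2] /andP[b1 b2].
  have le u v : (u%:R : R) + 2 * s <= v%:R + 1 -> (u <= v)%N.
    by move=> uv; rewrite -ltnS -(ltr_nat R) -addn1 natrD; lra.
  by apply/eqP; rewrite eqn_leq; apply/andP; split; apply: le; lra.
apply: (@le_trans _ _ (mu (\big[setU/set0]_(i < #|G|) F i))).
  rewrite measure_bigsetU_ord // (eq_bigr (fun=> ((1 - 2 * s) ^+ d)%:E)) => [|i _].
    by rewrite sumEFin sumr_const card_ord mulr_natl.
  exact: muF.
apply: le_measure; rewrite ?inE //; first exact: bigsetU_measurable.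
apply: (big_ind (fun A => A `<=` S)) => //.
  by move=> A B AS BS; rewrite subUset.
by move=> i _; apply: GS; exact: enum_valP.
Qed.

(** Distributivity factors the sum over lattice points into one-dimensional sums; the bound by [M]
    keeps each window inside the index range. *)
Lemma prod_cnt M (t e n : 'I_d -> nat) : (forall i, (e i + n i <= M)%N) ->
  \sum_(k : {ffun 'I_d -> 'I_M}) \prod_i
      ((t i * (t i %| k i))%:R * (e i <= k i < e i + n i)%N%:R : R) =
  \prod_i (t i * cnt (t i) (e i) (n i))%:R.
Proof.
move=> enM; rewrite -(bigA_distr_bigA (fun i (q : 'I_M) =>
   ((t i * (t i %| q))%:R * (e i <= q < e i + n i)%N%:R : R))) /=.
apply: eq_bigr => i _; rewrite /cnt big_distrr /= natr_sum.
rewrite -(big_mkord xpredT (fun q => (t i * (t i %| q))%:R * (e i <= q < e i + n i)%N%:R)).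
rewrite (eq_bigr (fun q => if (e i <= q < e i + n i)%N then (t i * (t i %| q))%:R else 0)); last first.
  by move=> q _; case: ifP; rewrite ?mulr1 ?mulr0.
rewrite -big_mkcond /= -(big_mkord xpredT (fun q => ((t i * (t i %| e i + q))%:R : R))).
transitivity (\sum_(e i <= q < e i + n i) ((t i * (t i %| q))%:R : R)).
  by rewrite [RHS](big_nat_widenl _ 0) // [RHS](big_nat_widen _ _ M).
rewrite -{1}[e i]add0n big_addn addKn; apply: eq_bigr => q _; by rewrite addnC.
Qed.

(** Test the inequality on bumps of radius [s = 1 / (8 d)] in a lattice of side [M], using cells
    with a margin [P0] on both sides. The margin and the shrinking of cells each cost a factor
    [(1 - 2 * s) ^+ d], together at least 1/2; half of the cells being good makes this 1/4. *)
Lemma weak11_const_ge (a c : R) (P0 : nat) (Ls : seq nat) (t : 'I_d -> nat) :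
  (0 < d)%N -> 1 <= a -> (0 < P0)%N -> (forall L, L \in Ls -> (0 < L <= P0)%N) ->
  (forall i, (0 < t i)%N && (t i %| P0)%N) ->
  2^-1 <= avg (fun x : {ffun 'I_d -> 'I_((8 * d - 2) * P0)} =>
      (has (fun L => a <= \prod_i ratio R (t i) (x i + (P0 + 1 - L)) (2 * L))%R Ls)%:R : R) ->
  weak11 mu c -> a / 4 <= c.
Proof.
move=> d0 a1 P00 LsP tP; set K := (8 * d - 2)%N; pose good (x : {ffun 'I_d -> 'I_(K * P0)}) :=
  has (fun L => a <= \prod_i ratio R (t i) (x i + (P0 + 1 - L)) (2 * L)) Ls.
rewrite -[avg _]/(avg (fun x => (good x)%:R)) => half wc.
pose M := (8 * d * P0)%N.
pose s : R := (8 * d%:R)^-1.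
have dR : 1 <= (d%:R : R) by rewrite ler1n.
have s0 : 0 < s by rewrite invr_gt0; lra.
have s1 : 2 * s <= 1 by rewrite /s ler_pdivrMr; lra.
pose w (k : {ffun 'I_d -> 'I_M}) : R := \prod_i (t i * (t i %| k i))%:R.
pose ct (k : {ffun 'I_d -> 'I_M}) : d.-tuple R := [tuple (k i)%:R | i < d].
have w0 k : 0 <= w k by apply: prodr_ge0.
have sw : \sum_k w k = M%:R ^+ d.
  have tot : \sum_k w k = \prod_(i < d) (t i * cnt (t i) 0 M)%:R.
    rewrite -(@prod_cnt M t (fun=> 0%N) (fun=> M)) //; apply: eq_bigr => k _.
    by apply: eq_bigr => i _; rewrite add0n leq0n ltn_ord mulr1.
  rewrite tot -[in RHS](card_ord d) -prodr_const; apply: eq_bigr => i _.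
  have /andP[t0 tP0] := tP i; have /dvdnP[q qE] : (t i %| M)%N by rewrite dvdn_mull.
  by rewrite qE mulnC [(q * t i)%N]mulnC cnt_periods // mulnC.
(* The bumps have height [w], not mass [w], so the level [a] is scaled by the volume of one bump. *)
pose al : R := a * (2 * s) ^+ d.
have al0 : 0 < al by rewrite mulr_gt0 ?exprn_gt0 ?mulr_gt0 //; lra.
have := wc al _ al0 (integrable_bumps hmu ct w0 (ltW s0)).
set S := [set x | _]; rewrite (integral_bumpsT hmu ct w0 (ltW s0)) sw => weak.
pose G := finset good.
have cells : ((#|G|%:R * (1 - 2 * s) ^+ d)%:E <= mu S)%E.
  apply: (@mu_ge_cells (K * P0) P0) => //.
    exact: (measurable_maximal_bumps hmu).
  move=> k; rewrite inE => /hasP[L LL aL] x xk.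
  have /andP[L0 LP] := LsP _ LL.
  rewrite /S /= (maximal_bumpsE hmu) //.
  apply: (@le_trans _ _ (((2 * L%:R) ^+ d)^-1 * bump_mass w ct s x L%:R)%:E); last first.
    by apply: ereal_sup_ubound; exists L%:R => //=; rewrite ltr0n.
  have L2 : 0 < (2 * L%:R : R) by rewrite mulr_gt0 ?ltr0n.
  rewrite lee_fin mulrC ler_pdivlMr ?exprn_gt0 //.
  pose e i := (k i + (P0 + 1 - L))%N.
  have eM i : (e i + 2 * L <= M)%N.
    rewrite /e /M; have := ltn_ord (k i); rewrite /K; nia.
  have -> : al * (2 * L%:R) ^+ d = a * (2 * L%:R) ^+ d * (2 * s) ^+ d by rewrite /al; ring.
  apply: (@le_trans _ _ (\prod_i (t i * cnt (t i) (e i) (2 * L))%:R * (2 * s) ^+ d)).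
    rewrite ler_pM2r ?exprn_gt0 ?mulr_gt0 // -ler_pdivlMr ?exprn_gt0 //.
    apply: le_trans aL _; rewrite /ratio prodf_div natrM prodr_const card_ord //.
  rewrite -(@prod_cnt M t e (fun=> (2 * L)%N)) // mulr_suml; apply: ler_sum => q _.
  have -> : (2 * s) ^+ d = \prod_(i < d) (2 * s) by rewrite prodr_const card_ord.
  rewrite /w /overlap -!big_split /=.
  apply: ler_prod => i _; rewrite !mulr_ge0 ?(ltW s0) //=.
  rewrite -mulrA ler_wpM2l //; have := xk i; rewrite !tnth_mktuple => /andP[x1 x2].
  (* For [q i] in the window, the bump's interval lies inside that of the large cube, since [x]
     stays at distance [s] from the ends of its cell; the overlap is then [2 * s]. *)
  case: andP => [[q1 q2]|_]; last by rewrite mul0r le_max lexx.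
  rewrite mul1r le_max; apply/orP; right.
  have aux1 (u v p l : nat) : (u + (p + 1 - l) <= v -> u + p + 1 <= v + l)%N by lia.
  have aux2 (u v p l : nat) : (l <= p -> v < u + (p + 1 - l) + 2 * l -> v <= u + p + l)%N by lia.
  have h1 : (k i + P0 + 1)%:R <= (q i + L)%:R :> R by rewrite ler_nat; exact: aux1 q1.
  have h2 : (q i)%:R <= (k i + P0 + L)%:R :> R by rewrite ler_nat; exact: aux2 LP q2.
  rewrite !natrD in h1 h2 x1 x2.
  rewrite lerBrDl -lerBrDr ge_max; apply/andP; split; rewrite lerBrDl addrC -lerBrDl;
    rewrite lerBrDl le_min; apply/andP; split; lra.
have {}half : 2^-1 * (K * P0)%:R ^+ d <= #|G|%:R :> R.
  have E : avg (fun x => (good x)%:R : R) = ((K * P0)%:R ^+ d)^-1 * #|G|%:R.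
    rewrite /avg card_ffun !card_ord natrX; congr (_ * _).
    rewrite -natr_sum; congr _%:R; rewrite -sum1_card [RHS]big_mkcond /=.
    by apply: eq_bigr => x _; rewrite inE; case: (good x).
  have KP0 : 0 < (K * P0)%:R ^+ d :> R.
    by rewrite exprn_gt0 // ltr0n muln_gt0 P00 andbT /K; lia.
  by move: half; rewrite E mulrC ler_pdivlMr.
have : al * (#|G|%:R * (1 - 2 * s) ^+ d) <= c * ((2 * s) ^+ d * M%:R ^+ d).
  rewrite -lee_fin [(al * _)%:E]EFinM [(c * _)%:E]EFinM; apply: le_trans weak.
  by rewrite lee_pmul2l ?lte_fin.
have -> : al * (#|G|%:R * (1 - 2 * s) ^+ d) = (2 * s) ^+ d * (a * (#|G|%:R * (1 - 2 * s) ^+ d)).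
  by rewrite /al; ring.
rewrite [c * _]mulrCA ler_pM2l ?exprn_gt0 ?mulr_gt0 // => weak2.
have M0 : 0 < M%:R ^+ d :> R by rewrite exprn_gt0 // ltr0n !muln_gt0 P00 d0.
have ber n : 1 - n%:R * (2 * s) <= (1 - 2 * s) ^+ n.
  elim: n => [|n IH]; first by rewrite mul0r subr0.
  rewrite exprS -addn1 natrD; have : 0 <= n%:R * (2 * s) ^+ 2 by rewrite mulr_ge0 ?sqr_ge0.
  nra.
have KM : (K * P0)%:R = M%:R * (1 - 2 * s) :> R.
  rewrite /K /M !natrM natrB; last by lia.
  by rewrite natrM /s; field; lra.
have b2 := ber (2 * d)%N; have : (2 * d)%:R * (2 * s) = 2^-1.
  by rewrite natrM /s; field; lra.
move=> E; rewrite E mulnC mulnS muln1 exprD in b2.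
rewrite -(ler_pM2r M0); apply: le_trans weak2.
rewrite -mulrA ler_pM2l; last by lra.
apply: (@le_trans _ _ (2^-1 * (K * P0)%:R ^+ d * (1 - 2 * s) ^+ d)); last first.
  by apply: ler_wpM2r => //; apply: exprn_ge0; lra.
rewrite KM exprMn.
set u := (1 - 2 * s) ^+ d in b2 *; set m := M%:R ^+ d in M0 *.
have -> : 2^-1 * (m * u) * u = m * (2^-1 * (u * u)) by ring.
rewrite mulrC ler_pM2l //; lra.
Qed.

End LowerBound.

Theorem mainTheorem1 (R : realType) (T : R) (hT : 0 < T) :
  exists D : nat, forall d : nat, (1 <= d)%N -> (D <= d)%N ->
    forall mu : {measure set (d.-tuple R) -> \bar R},
      is_lebesgue_measure mu ->
      (T%:E <= best_weak11_const mu)%E.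
Proof.
(* The level [4 * T + 4] is at least 1, and a quarter of it exceeds [T]. *)
have a1 : 1 <= 4 * T + 4 by lra.
have [D [P0 [Ls [P00 [LsP H]]]]] := half_cells_have_large_average a1.
exists D => d d1 Dd mu hmu; have [t [tP half]] := H d Dd.
apply/ereal_infP => _ [c [_ wc] <-]; rewrite lee_fin.
have K0 : (0 < 8 * d - 2)%N by lia.
have := weak11_const_ge hmu d1 a1 P00 LsP tP (half _ K0) wc; lra.
Qed.
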